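(* There exist a Polish space $E$ with a complete metric $d$ generating its topology, a probability space $(\Omega,\mathscr F,\mathbb P)$ with a measurable $\mathbb P$-preserving flow $(\vartheta_t)_{t\in\mathbb R}$, a random dynamical system $\varphi:[0,\infty)\times E\times\Omega\to E$ over it, and a non-empty family $\mathcal B$ of subsets of $E\times\Omega$, such that $\varphi$ has a random forward attractor for $\mathcal B$ (with respect to $d$), but has no smallest random forward attractor for $\mathcal B$; that is, there is no random forward attractor $A$ for $\mathcal B$ such that $A(\omega)\subset A'(\omega)$ almost surely for every random forward attractor $A'$ for $\mathcal B$.
   Context: For $x\in E$, $A\subset E$: $d(x,A)=\inf\{d(x,a):a\in A\}$, $d(x,\emptyset)=\infty$. For non-empty $A,B\subset E$, $d(B,A):=\sup\{d(b,A):b\in B\}$; $d(\emptyset,A):=0$, and $d(B,\emptyset):=\infty$ if $B\ne\emptyset$. $E$ carries its Borel $\sigma$-algebra. A measurable $\mathbb P$-preserving flow is a measurable map $\vartheta:\mathbb R\times\Omega\to\Omega$, $(t,\omega)\mapsto\vartheta_t\omega$, with each $\vartheta_t$ preserving $\mathbb P$, $\vartheta_{t+s}=\vartheta_t\circ\vartheta_s$, $\vartheta_0=\mathrm{id}$. A random dynamical system over it is a measurable map $\varphi:[0,\infty)\times E\times\Omega\to E$, $(t,x,\omega)\mapsto\varphi(t,\omega)x$, such that for all $\omega\in\Omega$: $\varphi(t,\omega):E\to E$ is continuous for every $t\ge0$; $\varphi(t+s,\omega)=\varphi(t,\vartheta_s\omega)\circ\varphi(s,\omega)$ for all $s,t\ge0$;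 $\varphi(0,\omega)=\mathrm{id}$. For $C\subset E\times\Omega$ put $C(\omega)=\{x:(x,\omega)\in C\}$. A compact random set is a set $C\subset E\times\Omega$ all of whose sections $C(\omega)$ are compact and for which $\omega\mapsto d(x,C(\omega))\in[0,\infty]$ is measurable for every $x\in E$. A property holds almost surely if there is a measurable set of full measure on which it holds. A random forward attractor for $\mathcal B$ (with respect to $d$) is a set $A\subset E\times\Omega$ such that: $A$ is a compact random set; for every $t\ge0$, $\varphi(t,\omega)A(\omega)=A(\vartheta_t\omega)$ $\mathbb P$-a.s.; and for every $B\in\mathcal B$, $\lim_{t\to\infty}d(\varphi(t,\omega)B(\omega),A(\vartheta_t\omega))=0$ $\mathbb P$-a.s. *)

(* Defs.v *)
From HB Require Import structures.
From mathcomp Require Import all_boot all_order all_algebra.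
From mathcomp Require Import all_classical all_reals all_analysis.
From mathcomp Require Import measurable_realfun metric_structure.

Set Implicit Arguments.
Unset Strict Implicit.
Unset Printing Implicit Defensive.

Import Order.TTheory GRing.Theory Num.Theory.
Import numFieldNormedType.Exports.

Local Open Scope classical_set_scope.
Local Open Scope ring_scope.

(* Metric spaces (with distance [mdist], which generates the topology) in which
   every Cauchy filter converges. *)
#[short(type="completeMetricType")]
HB.structure Definition CompleteMetric (R : numDomainType) :=
  {E of Complete E & Metric R E}.

Definition separable (E : topologicalType) : Prop :=
  exists2 D : set E, countable D & dense D.

(* E with its Borel sigma-algebra *)
Definition borel (E : ptopologicalType) : measurableType (@open E).-sigma :=
  g_sigma_algebraType (@open E).

Section SetDistance.
Context {R : realType} {E : metricType R}.

(* The infimum of the empty set is +oo in \bar R, so d(x, set0) = +oo. *)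
Definition dist_pt (x : E) (A : set E) : \bar R :=
  ereal_inf [set (mdist x a)%:E | a in A].

(* The supremum of the empty set is -oo in \bar R, hence the case distinction.
   For B nonempty, d(B, set0) = +oo. *)
Definition dist_set (B A : set E) : \bar R :=
  if B == set0 then 0%E else ereal_sup [set dist_pt b A | b in B].

End SetDistance.

Section RandomDynamics.
Context {R : realType} {E : completeMetricType R}.
Context {dO : measure_display} {Omega : measurableType dO}.

Record preserving_flow (P : probability Omega R) (theta : R -> Omega -> Omega)
    : Prop := PreservingFlow {
  flow_measurable : measurable_fun setT
    (fun z : measurableTypeR R * Omega => theta z.1 z.2) ;
  flow_preserving : forall (t : R) (F : set Omega),
    measurable F -> P (theta t @^-1` F) = P F ;
  flowD : forall s t : R, theta (t + s) = theta t \o theta s ;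
  flow0 : theta 0 = id }.

(* [phi t w x] stands for phi(t, omega) x. Only the values of phi for t >= 0
   are constrained or used. *)
Record random_dynamical_system (theta : R -> Omega -> Omega)
    (phi : R -> Omega -> E -> E) : Prop := RandomDynamicalSystem {
  rds_measurable : measurable_fun
    [set z : measurableTypeR R * borel E * Omega | 0 <= z.1.1]
    (fun z : measurableTypeR R * borel E * Omega =>
       phi z.1.1 z.2 z.1.2 : borel E) ;
  rds_continuous : forall (w : Omega) (t : R), 0 <= t -> continuous (phi t w) ;
  rds_cocycle : forall (w : Omega) (s t : R), 0 <= s -> 0 <= t ->
    phi (t + s) w = phi t (theta s w) \o phi s w ;
  rds0 : forall w : Omega, phi 0 w = id }.

(* The section C(omega) of C is [ysection C omega]. *)
Definition compact_random_set (C : set (E * Omega)) : Prop :=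
  (forall w : Omega, compact (ysection C w)) /\
  (forall x : E, measurable_fun setT
     (fun w : Omega => dist_pt x (ysection C w))).

Record random_forward_attractor (P : probability Omega R)
    (theta : R -> Omega -> Omega) (phi : R -> Omega -> E -> E)
    (BB : set (set (E * Omega))) (A : set (E * Omega)) : Prop :=
    RandomForwardAttractor {
  attractor_compact : compact_random_set A ;
  attractor_invariant : forall t : R, 0 <= t -> \forall w \ae P,
    phi t w @` ysection A w = ysection A (theta t w) ;
  attractor_attracts : forall B : set (E * Omega), BB B -> \forall w \ae P,
    dist_set (phi t w @` ysection B w) (ysection A (theta t w))
      @[t --> +oo%R] --> 0%E }.

Definition smallest_random_forward_attractor (P : probability Omega R)
    (theta : R -> Omega -> Omega) (phi : R -> Omega -> E -> E)
    (BB : set (set (E * Omega))) (A : set (E * Omega)) : Prop :=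
  random_forward_attractor P theta phi BB A /\
  forall A' : set (E * Omega), random_forward_attractor P theta phi BB A' ->
    \forall w \ae P, ysection A w `<=` ysection A' w.

End RandomDynamics.

(* Main.v *)
Require Import Defs.
From HB Require Import structures.
From mathcomp Require Import all_boot all_order all_algebra.
From mathcomp Require Import all_classical all_reals all_analysis.
From mathcomp Require Import measurable_realfun metric_structure zify ring lra.

Set Implicit Arguments.
Unset Strict Implicit.
Unset Printing Implicit Defensive.

Import Order.TTheory GRing.Theory Num.Theory.
Import numFieldNormedType.Exports.

Local Open Scope classical_set_scope.
Local Open Scope ring_scope.

(** A smallest attractor would lie in the intersection of any two attractors,
and then that intersection would attract as well.  It therefore suffices to
build two forward attractors whose intersection does not attract.

The base flow is the rotation of the circle, with period 1 in continuous time.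
In fixed coordinates of the plane, one turn acts by g (x, y) = (x^2, y^2).  The
horizontal segment [0, 1] x {0} and the diagonal {(u, u) : 0 <= u <= 1} are
compact and mapped onto themselves by g, and they meet only at the origin.  At
the phase c of the circle these coordinates are stretched horizontally by an
integer factor s(c) that is unbounded as c tends to 0 from the right.  This
gives the cocycle [plane_rds] and the two attractors [stretched_attractor].

The single attracted set is the point that starts at (1/2, 0) in the
unstretched coordinates.  After n turns it is (s(c) h, 0), where
h = (1/2)^(2^n).  It lies on the stretched horizontal segment, and the point
(s(c) h, h) of the stretched diagonal is at distance h from it.  This bound does
not depend on c, so both sets attract ([stretched_attracts]).  Its distance to
the origin is s(c) h, however.  Between the n-th passage of the phase 0 and the
next one, c runs through an interval on which s exceeds 1 / h, so this distance
does not tend to 0.  As a set of full measure contains such phases c for every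
n, no attractor has all its sections contained in the origin almost surely
([no_smallest_attractor]). *)

(** * Product metric and the plane *)

Section ProductMetric.
Context {R : realFieldType} {U V : metricType R}.
Implicit Types p q : U * V.

Definition prod_mdist p q : R := Num.max (mdist p.1 q.1) (mdist p.2 q.2).

Lemma prod_mdist_ge0 p q : 0 <= prod_mdist p q.
Proof. by rewrite le_max mdist_ge0. Qed.

Lemma prod_mdist_positivity p q : prod_mdist p q = 0 -> p = q.
Proof.
case: p q => [p1 p2] [q1 q2] pq0.
have : prod_mdist (p1, p2) (q1, q2) <= 0 by rewrite pq0.
rewrite ge_max /= => /andP[d1 d2]; congr pair; apply: mdist_positivity;
  by apply/eqP; rewrite eq_le mdist_ge0 andbT.
Qed.

Lemma ball_prod_mdist p e : ball p e = [set q | prod_mdist p q < e].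
Proof.
apply/seteqP; split=> q /=.
  by move=> [b1 b2]; move: b1 b2; rewrite gt_max !ballEmdist => /= -> ->.
by rewrite gt_max => /andP[d1 d2]; split; rewrite ballEmdist.
Qed.

HB.instance Definition _ := @PseudoMetric_isMetric.Build R (U * V)%type
  prod_mdist prod_mdist_ge0 prod_mdist_positivity ball_prod_mdist.

End ProductMetric.

Section ProductComplete.
Context {U V : completeType}.

(* The product is pointed and uniform, but the join of both structures has to
   be declared before [cvg F] can be stated. *)
HB.instance Definition _ := Pointed.on (U * V)%type.

Lemma prod_cauchy_cvg (F : set_system (U * V)) :
  ProperFilter F -> cauchy F -> cvg F.
Proof.
move=> FF Fc.
have c1 : cauchy (fst @ F).
  move=> A entA.
  have [|[B1 B2] /= [FB1 FB2] BA] := Fc [set x | A (x.1.1, x.2.1)].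
    exists (A, setT) => /=; first by split=> //; exact: filterT.
    by move=> [[a b] [c d]] /= [Aab _]; exists ((a, c), (b, d)).
  exists (fst @` B1, fst @` B2).
    by split=> /=; [move: FB1 | move: FB2]; apply: filterS => x Bx; exists x.
  by move=> [_ _] /= [[x B1x <-] [y B2y <-]]; exact: (BA (x, y)).
have c2 : cauchy (snd @ F).
  move=> A entA.
  have [|[B1 B2] /= [FB1 FB2] BA] := Fc [set x | A (x.1.2, x.2.2)].
    exists (setT, A) => /=; first by split=> //; exact: filterT.
    by move=> [[a b] [c d]] /= [_ Acd]; exists ((a, c), (b, d)).
  exists (snd @` B1, snd @` B2).
    by split=> /=; [move: FB1 | move: FB2]; apply: filterS => x Bx; exists x.
  by move=> [_ _] /= [[x B1x <-] [y B2y <-]]; exact: (BA (x, y)).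
apply/cvg_ex; exists (lim (fst @ F), lim (snd @ F)).
move=> A /(cvg_pair (cauchy_cvg _ c1) (cauchy_cvg _ c2)).
by move=> FA; apply: (@filterS _ F _ [set x | A (x.1, x.2)]) FA => -[a b].
Qed.

HB.instance Definition _ :=
  Uniform_isComplete.Build (U * V)%type prod_cauchy_cvg.

End ProductComplete.

Definition plane (R : realType) : completeMetricType R :=
  HB.pack_for (completeMetricType R) (R^o * R^o)%type.

Lemma mdist_plane (R : realType) (p q : plane R) :
  mdist p q = Num.max `|q.1 - p.1| `|q.2 - p.2|.
Proof. by []. Qed.

(** * Countable-valued measurable maps *)

Section CountableValued.
Context d (T : measurableType d).

(** Measurability of a countable-valued N, expressed by its level sets, so that
no sigma-algebra on I is needed. *)
Definition measurable_levels (I : countType) (D : set T) (N : T -> I) :=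
  forall i, measurable (D `&` N @^-1` [set i]).

Lemma measurable_levels_comp (I J : countType) (D : set T) (N : T -> I)
    (g : I -> J) : measurable_levels D N -> measurable_levels D (g \o N).
Proof.
move=> mN j.
rewrite (_ : _ `&` _ =
    \bigcup_i (if g i == j then D `&` N @^-1` [set i] else set0)).
  by apply: countable_bigcupT_measurable => // i; case: (g i == j).
apply/seteqP; split=> [x [Dx /= gj]|x [i _]].
  by exists (N x) => //; rewrite gj eqxx.
by case: eqP => // gi [Dx /= Nx]; split=> //=; rewrite Nx.
Qed.

Lemma measurable_levels_pair (I J : countType) (D : set T)
    (M : T -> I) (N : T -> J) : measurable_levels D M ->
  measurable_levels D N -> measurable_levels D (fun x => (M x, N x)).
Proof.
move=> mM mN [i j].
rewrite (_ : _ `&` _ =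
    (D `&` M @^-1` [set i]) `&` (D `&` N @^-1` [set j])).
  exact: measurableI.
by apply/seteqP; split=> [x [Dx [/= ? ?]]|x [[Dx /= <-] [_ <-]]].
Qed.

(** The dynamics is a measurable selection among countably many continuous maps;
this reduces its measurability to that of the index. *)
Lemma measurable_fun_glue d' (U : measurableType d') (I : countType)
    (D : set T) (N : T -> I) (f : I -> T -> U) :
    measurable_levels D N -> (forall i, measurable_fun D (f i)) ->
  measurable_fun D (fun x => f (N x) x).
Proof.
move=> mN mf mD Y mY.
rewrite (_ : _ `&` _ =
    \bigcup_i ((D `&` N @^-1` [set i]) `&` (D `&` f i @^-1` Y))).
  by apply: countable_bigcupT_measurable => // i; apply: measurableI;
    [exact: mN | exact: mf].
apply/seteqP; split=> [x [Dx Yx]|x [i _ [[Dx /= ->] [_ ?]]]] //.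
by exists (N x).
Qed.

Lemma measurable_levels_floor (R : realType) (D : set T)
    (f : T -> measurableTypeR R) : measurable D -> measurable_fun D f ->
  measurable_levels D (fun x => Num.floor (f x)).
Proof.
move=> mD mf i.
rewrite (_ : _ `&` _ = D `&` f @^-1` `[i%:~R, (i + 1)%:~R[%classic).
  exact: mf.
apply/seteqP; split=> x [Dx /=].
  by move=> fi; split=> //=; rewrite in_itv/= -floor_eq fi.
by rewrite in_itv/= -floor_eq => /eqP.
Qed.

End CountableValued.

(** * Distances *)

Section Distances.
Context {R : realType} {E : completeMetricType R}.
Implicit Types p q : E.

Lemma dist_set1 p (C : set E) : dist_set [set p] C = dist_pt p C.
Proof.
rewrite /dist_set ifF ?image_set1 ?ereal_sup1//.
by apply/negbTE/set0P; exists p.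
Qed.

Lemma dist_pt_ge0 p (C : set E) : (0 <= dist_pt p C)%E.
Proof. by apply: le_ereal_inf_tmp => _ [q _ <-]; rewrite lee_fin mdist_ge0. Qed.

Lemma dist_pt_le p (C : set E) q :
  C q -> (dist_pt p C <= (mdist p q)%:E)%E.
Proof. by move=> Cq; apply: ereal_inf_lbound; exists q. Qed.

End Distances.

(** * The rotation flow *)

Section BaseFlow.
Context {R : realType}.
Local Notation line := (measurableTypeR R).
Implicit Types (t w : R) (F : set line).

Definition phase w : R := w - (Num.floor w)%:~R.

(** The rotation of the circle, acting on every interval [n, n + 1) separately,
so that R itself serves as sample space; the probability only charges [0, 1). *)
Definition rotate t w : R := (Num.floor w)%:~R + phase (w + t).

Lemma phase_ge0 w : 0 <= phase w.
Proof. by rewrite subr_ge0 floor_le. Qed.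

Lemma phase_lt1 w : phase w < 1.
Proof. by rewrite ltrBlDl -intrD1 floorD1_gt. Qed.

Lemma floorDint w (m : int) :
  Num.floor (w + m%:~R) = Num.floor w + m.
Proof. by rewrite floorDrz ?intr_int// intrKfloor. Qed.

Lemma phaseDint w (m : int) : phase (w + m%:~R) = phase w.
Proof. by rewrite /phase floorDint intrD; ring. Qed.

Lemma floor_unit w : 0 <= w < 1 -> Num.floor w = 0.
Proof. by move=> w01; apply: floor_def; rewrite add0r. Qed.

Lemma floor_rotate t w : Num.floor (rotate t w) = Num.floor w.
Proof.
rewrite /rotate addrC floorDint floor_unit ?add0r//.
by rewrite phase_ge0 phase_lt1.
Qed.

(** Up to an integer, [rotate s] is the translation by s; every quantity that
depends on the phase only can thus be computed at w + s + t. *)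
Lemma rotateD_int s t w :
  rotate s w + t = w + s + t + (Num.floor w - Num.floor (w + s))%:~R.
Proof. by rewrite /rotate /phase intrB; ring. Qed.

Lemma rotateD s t : rotate (t + s) = rotate t \o rotate s.
Proof.
apply/funext => w.
rewrite -[RHS]/((Num.floor (rotate s w))%:~R + phase (rotate s w + t)).
rewrite floor_rotate rotateD_int phaseDint.
by rewrite /rotate (_ : w + (t + s) = w + s + t)//; ring.
Qed.

Lemma rotate0 : rotate 0 = id.
Proof. by apply/funext => w; rewrite /rotate /phase addr0/=; ring. Qed.

Lemma measurable_rotate (D : set (line * line)) :
  measurable D ->
  measurable_fun D (fun z : line * line =>
    rotate z.1 z.2 : line).
Proof.
move=> mD.
have m1 : measurable_fun D
    (fun z : line * line => z.2 + z.1 : line).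
  by apply: measurable_funD; apply: measurable_funTS;
    [exact: measurable_snd | exact: measurable_fst].
have m2 : measurable_fun D
    (fun z : line * line => z.2 : line).
  by apply: measurable_funTS; exact: measurable_snd.
have L := measurable_levels_pair
  (measurable_levels_floor mD m2) (measurable_levels_floor mD m1).
apply: (@measurable_fun_glue _ _ _ _ _ D _
  (fun (i : int * int) (z : line * line) =>
     i.1%:~R + (z.2 + z.1 - i.2%:~R) : line) L) => -[i j].
apply: measurable_funD => //; exact: measurable_funB.
Qed.

(** The push-forward of Lebesgue measure by a translation agrees with it on
half-open intervals. *)
Lemma lebesgue_measure_shift (a : R) F : measurable F ->
  lebesgue_measure ((fun x => x + a : line) @^-1` F) =
  lebesgue_measure F.
Proof.
move=> mF; apply/esym.
have ms : measurable_fun setT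
    (fun x : line => x + a : line).
  exact: measurable_funD.
pose mu := [the measure _ _ of pushforward (@lebesgue_measure R)
  (fun x : line => x + a : line)].
apply: (@lebesgue_measure_unique R (mu ms)) => // _ [[u v] _ <-] /=.
rewrite /pushforward (_ : _ @^-1` _ = `]u - a, v - a]%classic); last first.
  by apply/seteqP; split=> x /=; rewrite !in_itv/= ltrBlDr lerBrDr.
rewrite !lebesgue_measure_itv /= !lte_fin ltrD2r -!EFinB.
by case: ifP => // _; congr (_%:E); ring.
Qed.

Definition unit_prob : set line -> \bar R :=
  mrestr (@lebesgue_measure R)
    (measurable_itv `[0, 1[ : measurable (`[0, 1[%classic : set line)).

HB.instance Definition _ := Measure.on unit_prob.

Lemma unit_probT : unit_prob setT = 1%E.
Proof.
by rewrite /unit_prob /mrestr setTI lebesgue_measure_itv/= lte_fin ltr01 sube0.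
Qed.

HB.instance Definition _ :=
  Measure_isProbability.Build _ _ _ unit_prob unit_probT.

(** On [0, 1) the rotation by t is an exchange of two intervals, one translated
by the phase a of t and the other one by a - 1. *)
Lemma rotate_preserving t F : measurable F ->
  unit_prob (rotate t @^-1` F) = unit_prob F.
Proof.
move=> mF; rewrite /unit_prob /mrestr.
set m := Num.floor t; set a := phase t.
have tE : t = a + m%:~R by rewrite /a /phase subrK.
have a0 : 0 <= a := phase_ge0 t.
have a1 : a < 1 := phase_lt1 t.
(* k tells whether the point passes 1. *)
have rotE (k : bool) w : 0 <= w < 1 -> k%:R <= w + a < k%:R + 1 ->
    rotate t w = w + a - k%:R.
  move=> w01 wa; rewrite /rotate floor_unit// add0r tE addrA phaseDint /phase.
  by congr (_ - _); rewrite (@floor_def _ _ k)// intrD.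
rewrite (_ : _ `&` _ =
  ((fun x => x + a : line) @^-1` (F `&` `[a, 1[%classic)) `|`
  ((fun x => x + (a - 1) : line) @^-1` (F `&` `[0, a[%classic)));
  last first.
  apply/seteqP; split=> x /=.
    rewrite !in_itv/= => -[Fx x01].
    case: (ltP (x + a) 1) => xa.
      have xa' : (false%:R : R) <= x + a < false%:R + 1.
        by move: x01 => /andP[? ?]; apply/andP; split=> /=; lra.
      move: Fx; rewrite (rotE _ _ x01 xa') subr0 => Fx; left; split=> //.
      by move: x01 => /andP[? ?]; apply/andP; split; lra.
    have xa' : (true%:R : R) <= x + a < true%:R + 1.
      by move: x01 => /andP[? ?]; apply/andP; split=> /=; lra.
    move: Fx; rewrite (rotE _ _ x01 xa') -addrA => Fx; right; split=> //.
    by move: x01 => /andP[? ?]; apply/andP; split; lra.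
  rewrite !in_itv/= => -[] [Fx /andP[? ?]].
    have x01 : 0 <= x < 1 by apply/andP; split; lra.
    have xa : (false%:R : R) <= x + a < false%:R + 1.
      by apply/andP; split=> /=; lra.
    by split=> //; rewrite (rotE _ _ x01 xa) subr0.
  have x01 : 0 <= x < 1 by apply/andP; split; lra.
  have xa : (true%:R : R) <= x + a < true%:R + 1.
    by apply/andP; split=> /=; lra.
  by split=> //; rewrite (rotE _ _ x01 xa) -addrA.
rewrite measureU; first last.
- rewrite -subset0 => x /= []; rewrite !in_itv/=.
  by move=> [_ /andP[? ?]] [_ /andP[? ?]]; lra.
- rewrite -[X in measurable X]setTI; apply: measurable_funD => //.
  exact: measurableI.
- rewrite -[X in measurable X]setTI; apply: measurable_funD => //.
  exact: measurableI.
transitivity (lebesgue_measure (F `&` `[a, 1%R[%classic) +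
    lebesgue_measure (F `&` `[0%R, a[%classic))%E.
  by congr (_ + _)%E; apply: lebesgue_measure_shift; exact: measurableI.
rewrite -measureU; try exact: measurableI; last first.
  rewrite -subset0 => x /= []; rewrite !in_itv/=.
  by move=> [_ /andP[? ?]] [_ /andP[? ?]]; lra.
rewrite -setIUr; congr (lebesgue_measure (_ `&` _)).
apply/seteqP; split=> x /=; rewrite !in_itv/=.
  by move=> [|] /andP[? ?]; apply/andP; split; lra.
move=> /andP[? ?].
by case: (ltP x a) => ?; [right|left]; apply/andP; split; lra.
Qed.

Lemma rotate_preserving_flow :
  preserving_flow (unit_prob : probability _ R) rotate.
Proof.
split.
- exact: measurable_rotate.
- exact: rotate_preserving.
- exact: rotateD.
- exact: rotate0.
Qed.

(** Produces the exceptional phases: no nondegenerate interval in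
[0, 1] is negligible. *)
Lemma ae_unit_prob_meets (Q : line -> Prop) (a b : R) :
  0 <= a -> a < b -> b <= 1 -> (\forall w \ae unit_prob, Q w) ->
  exists2 w : R, a < w < b & Q w.
Proof.
move=> a0 ab b1 [N [mN N0 QN]]; apply: contrapT => nQ.
have abN : `]a, b[%classic `<=` N.
  move=> w /=; rewrite in_itv/= => wab; apply: QN => /= Qw.
  by apply: nQ; exists w.
have : (unit_prob (`]a, b[%classic : set line) <= 0)%E.
  by rewrite -N0; apply: le_measure => //; rewrite inE//; exact: measurable_itv.
rewrite /unit_prob /mrestr (_ : _ `&` _ = `]a, b[%classic); last first.
  apply/seteqP; split=> x /=; rewrite !in_itv/=; first by case.
  move=> /andP[? ?].
  by split=> //; apply/andP; split; lra.
by rewrite lebesgue_measure_itv/= lte_fin ab -EFinB lee_fin subr_le0 leNgt ab.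
Qed.

End BaseFlow.

(** * The cocycle *)

Section PlaneDynamics.
Context {R : realType}.
Local Notation line := (measurableTypeR R).
Local Notation time_space_sample := (line * borel (plane R) * line)%type.
Implicit Types (t w u : R) (p : plane R).

(** The horizontal stretching factor at w is (level w).+1.  It is unbounded near
the phase 0, and it takes integer values so that only countably many maps and
sections occur. *)
Definition level w : nat := Num.truncn (- ln (phase w)).
Definition turns t w : nat := `|Num.floor (w + t) - Num.floor w|%N.

(** n turns of (x, y) |-> (x^2, y^2), read in coordinates that are stretched by
k.+1 at the source and by l.+1 at the target. *)
Definition rescaled_power (n k l : nat) p : plane R :=
  (l.+1%:R * (p.1 / k.+1%:R) ^+ (2 ^ n), p.2 ^+ (2 ^ n)).

Definition plane_rds t w : plane R -> plane R :=
  rescaled_power (turns t w) (level w) (level (w + t)).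

Lemma rescaled_powerD n m k l r p :
  rescaled_power (n + m) k r p = rescaled_power n l r (rescaled_power m k l p).
Proof.
rewrite /rescaled_power /= mulrAC divff ?pnatr_eq0// mul1r.
by rewrite -!exprM -expnD addnC.
Qed.

Lemma rescaled_power0 k p : rescaled_power 0 k k p = p.
Proof.
case: p => x y; rewrite /rescaled_power /= expn0 !expr1.
by rewrite mulrCA divff ?mulr1// pnatr_eq0.
Qed.

Lemma levelDint w (m : int) : level (w + m%:~R) = level w.
Proof. by rewrite /level phaseDint. Qed.

Lemma level_rotate t w : level (rotate t w) = level (w + t).
Proof. by rewrite -[rotate t w]addr0 rotateD_int addr0 levelDint. Qed.

Lemma turns_cocycle s t w : 0 <= s -> 0 <= t ->
  turns (t + s) w = (turns t (rotate s w) + turns s w)%N.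
Proof.
move=> s0 t0; rewrite /turns rotateD_int floorDint floor_rotate.
rewrite (_ : w + (t + s) = w + s + t); last by ring.
have h1 : Num.floor w <= Num.floor (w + s) by apply: le_floor; rewrite lerDl.
have h2 : Num.floor (w + s) <= Num.floor (w + s + t).
  by apply: le_floor; rewrite lerDl.
apply/eqP; rewrite -eqz_nat PoszD !gez0_abs; lia.
Qed.

Lemma plane_rds_cocycle w s t : 0 <= s -> 0 <= t ->
  plane_rds (t + s) w = plane_rds t (rotate s w) \o plane_rds s w.
Proof.
move=> s0 t0; apply/funext => p; rewrite /plane_rds /= level_rotate.
rewrite -rescaled_powerD turns_cocycle// rotateD_int levelDint.
by rewrite (_ : w + (t + s) = w + s + t)//; ring.
Qed.

Lemma plane_rds0 w : plane_rds 0 w = id.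
Proof.
by apply/funext => p; rewrite /plane_rds /turns addr0 subrr rescaled_power0.
Qed.

Lemma continuous_rescaled_power n k l : continuous (rescaled_power n k l).
Proof.
move=> p.
have c1 : {for p, continuous (fun q : plane R =>
    l.+1%:R * (q.1 / k.+1%:R) ^+ (2 ^ n) : R)}.
  apply: cvgM; first exact: cvg_cst.
  apply: (@continuous_comp _ _ _ (fun q : plane R => q.1 / k.+1%:R : R)
    (fun u : R => u ^+ (2 ^ n))); last exact: exprn_continuous.
  by apply: cvgM; [exact: cvg_fst | exact: cvg_cst].
have c2 : {for p, continuous (fun q : plane R => q.2 ^+ (2 ^ n) : R)}.
  apply: (@continuous_comp _ _ _ (fun q : plane R => q.2 : R)
    (fun u : R => u ^+ (2 ^ n))); last exact: exprn_continuous.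
  exact: cvg_snd.
exact: (cvg_pair c1 c2).
Qed.

Lemma measurable_continuous_borel (X Y : ptopologicalType) (f : X -> Y) :
  continuous f -> measurable_fun setT (f : borel X -> borel Y).
Proof.
move=> cf; apply: (@measurability _ _ (borel X) (borel Y) _ _ (@open Y)) => //.
move=> _ [V oV <-]; rewrite setTI; apply: sub_sigma_algebra.
by apply: open_comp => // x _; exact: cf.
Qed.

Lemma measurable_levels_level d (T : measurableType d) (D : set T)
    (f : T -> line) : measurable D -> measurable_fun D f ->
  measurable_levels D (fun x => level (f x)).
Proof.
move=> mD mf.
have mphase : measurable_fun D (fun x => phase (f x) : line).
  apply: (measurable_fun_glue (f := fun i x => f x - i%:~R : line)
    (measurable_levels_floor mD mf)) => i.
  exact: measurable_funB.
have mln : measurable_fun D (fun x => - ln (phase (f x)) : line).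
  by apply: measurableT_comp => //; apply: measurableT_comp.
have := measurable_levels_comp (fun i : int => if 0 <= i then `|i|%N else 0%N)
  (measurable_levels_floor mD mln).
rewrite (_ : _ \o _ = fun x => level (f x))//; apply/funext => x /=.
by rewrite /level truncn_floor floor_ge0.
Qed.

(** Every [plane_rds t w] is one of the continuous maps [rescaled_power n k l],
with an index that depends measurably on t and w. *)
Lemma plane_rds_measurable : measurable_fun
    [set z : time_space_sample | 0 <= z.1.1]
    (fun z : time_space_sample =>
       plane_rds z.1.1 z.2 z.1.2 : borel (plane R)).
Proof.
set D := [set z | _].
have m1 : measurable_fun setT
  (fun z : time_space_sample => z.1.1).
  exact: (measurableT_comp (@measurable_fst _ _ _ _) (@measurable_fst _ _ _ _)).
have mD : measurable D.
  rewrite (_ : D = setT `&` (fun z => z.1.1) @^-1` `[0, +oo[%classic).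
    by apply: m1 => //; exact: measurable_itv.
  by rewrite setTI; apply/seteqP; split=> z /=; rewrite in_itv/= andbT.
have m1D := measurable_funTS m1 : measurable_fun D _.
have m2D : measurable_fun D
  (fun z : time_space_sample => z.2).
  by apply: measurable_funTS; exact: measurable_snd.
have msD : measurable_fun D
  (fun z : time_space_sample => z.2 + z.1.1 : line).
  exact: measurable_funD.
have L := measurable_levels_pair
  (measurable_levels_pair
    (measurable_levels_floor mD msD) (measurable_levels_floor mD m2D))
  (measurable_levels_pair
    (measurable_levels_level mD m2D) (measurable_levels_level mD msD)).
apply: (@measurable_fun_glue _ _ _ _ _ D _
  (fun (i : (int * int) * (nat * nat)) (z : time_space_sample) =>
    rescaled_power `|i.1.1 - i.1.2|%N i.2.1 i.2.2 z.1.2 : borel (plane R)) L)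
  => i.
apply: (measurableT_comp
  (measurable_continuous_borel (@continuous_rescaled_power _ _ _))).
apply: measurable_funTS.
exact: (measurableT_comp (@measurable_snd _ _ _ _) (@measurable_fst _ _ _ _)).
Qed.

Lemma plane_rdsP : random_dynamical_system
  (rotate : R -> line -> line) plane_rds.
Proof.
split.
- exact: plane_rds_measurable.
- by move=> w t _; exact: continuous_rescaled_power.
- exact: plane_rds_cocycle.
- exact: plane_rds0.
Qed.

Lemma separable_plane : separable (plane R).
Proof.
exists (range (fun q : rat * rat => (ratr q.1, ratr q.2) : plane R)).
  by apply: (sub_countable (card_image_le _ _)); exact: countableP.
move=> W [[x y] Wxy] oW.
have [[A B] /= [Ax By] ABW] : nbhs ((x, y) : plane R) W.
  exact: open_nbhs_nbhs.
have ex (z : R) (C : set R) : nbhs z C -> exists q : rat, C (ratr q).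
  rewrite nbhsE => -[V [oV Vz] VC].
  have [y' [Vy' [q _ qE]]] := dense_rat (ex_intro _ z Vz) oV.
  by exists q; apply: VC; rewrite qE.
have [q Aq] := ex _ _ Ax; have [r Br] := ex _ _ By.
by exists (ratr q, ratr r); split; [exact: (ABW (_, _)) | exists (q, r)].
Qed.

End PlaneDynamics.

(** * The two attractors and their intersection *)

Section Attractors.
Context {R : realType}.
Local Notation line := (measurableTypeR R).
Implicit Types (b : bool) (t w u : R) (k l n : nat) (p : plane R).

(** The point of parameter u on the horizontal segment (b = false) or on the
diagonal (b = true), stretched by k.+1. *)
Definition segment_point b k u : plane R := (k.+1%:R * u, b%:R * u).

Definition stretched_segment b k : set (plane R) :=
  segment_point b k @` `[0, 1]%classic.

Definition stretched_attractor b : set (plane R * line) :=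
  [set z | stretched_segment b (level z.2) z.1].

Definition moving_point : set (plane R * line) :=
  [set z | z.1 = segment_point false (level z.2) 2^-1].

Lemma ysection_stretched b w :
  ysection (stretched_attractor b) w = stretched_segment b (level w).
Proof.
by apply/seteqP; split=> p; [move/ysectionP | move=> Sp; apply/ysectionP].
Qed.

Lemma ysection_moving_point w :
  ysection moving_point w = [set segment_point false (level w) 2^-1].
Proof.
by apply/seteqP; split=> p; [move/ysectionP | move=> Sp; apply/ysectionP].
Qed.

(** Both segments are handled at once because b ^ (2 ^ n) = b for b = 0 and
b = 1. *)
Lemma rescaled_power_segment b n k l u :
  rescaled_power n k l (segment_point b k u) = segment_point b l (u ^+ (2 ^ n)).
Proof.
rewrite /rescaled_power /segment_point /= mulrAC divff ?pnatr_eq0// mul1r.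
by rewrite exprMn; case: b; rewrite ?expr1n// expr0n expn_eq0.
Qed.

Lemma unit_root_pow2 n u : 0 <= u <= 1 ->
  exists2 v, 0 <= v <= 1 & v ^+ (2 ^ n) = u.
Proof.
elim: n u => [|n IH] u /andP[u0 u1].
  by exists u; rewrite ?u0 ?u1// expn0 expr1.
have [|v v01 vE] := IH (Num.sqrt u); last first.
  by exists v => //; rewrite expnSr exprM vE sqr_sqrtr.
by rewrite sqrtr_ge0/= -sqrtr1 ler_wsqrtr.
Qed.

Lemma rescaled_power_stretched b n k l :
  rescaled_power n k l @` stretched_segment b k = stretched_segment b l.
Proof.
apply/seteqP; split=> p /=.
  move=> [_ [u u01 <-] <-]; move: u01; rewrite /= in_itv/= => /andP[u0 u1].
  rewrite rescaled_power_segment; exists (u ^+ (2 ^ n)) => //=.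
  by rewrite in_itv/= exprn_ge0// exprn_ile1.
move=> [u] /=; rewrite in_itv/= => /(unit_root_pow2 n)[v v01 <- <-].
exists (segment_point b k v); last exact: rescaled_power_segment.
by exists v => //=; rewrite in_itv.
Qed.

Lemma compact_stretched b k : compact (stretched_segment b k).
Proof.
apply: continuous_compact; last exact: segment_compact.
apply: continuous_subspaceT => u.
have c1 : {for u, continuous (fun u : R => k.+1%:R * u : R)}.
  by apply: cvgM; [exact: cvg_cst | exact: cvg_id].
have c2 : {for u, continuous (fun u : R => b%:R * u : R)}.
  by apply: cvgM; [exact: cvg_cst | exact: cvg_id].
exact: (cvg_pair c1 c2).
Qed.

Lemma compact_random_stretched b : compact_random_set (stretched_attractor b).
Proof.
split=> [w|p]; first by rewrite ysection_stretched; exact: compact_stretched.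
under eq_fun do rewrite ysection_stretched.
apply: (measurable_fun_glue (N := level)
  (f := fun k _ => dist_pt p (stretched_segment b k))) => // k.
exact: measurable_levels_level.
Qed.

Lemma image_moving_point t w : plane_rds t w @` ysection moving_point w =
  [set segment_point false (level (w + t)) (2^-1 ^+ (2 ^ turns t w))].
Proof.
by rewrite ysection_moving_point image_set1 /plane_rds rescaled_power_segment.
Qed.

(** The point of the other segment with the same parameter is at distance at
most u, however large the stretching factor is. *)
Lemma dist_stretched b k u : 0 <= u <= 1 ->
  (dist_pt (segment_point false k u) (stretched_segment b k) <= u%:E)%E.
Proof.
move=> u01; have [u0 _] := andP u01.
apply: (le_trans (@dist_pt_le _ _ _ _ (segment_point b k u) _)).
  by exists u.
rewrite lee_fin mdist_plane /= subrr normr0 mul0r subr0 ge_max u0/=.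
by case: b; rewrite ?mul1r ?mul0r ?normr0// ger0_norm.
Qed.

Lemma turns_gt t w : 0 <= t -> t - 1 < (turns t w)%:R.
Proof.
move=> t0; have le_fl : Num.floor w <= Num.floor (w + t).
  by apply: le_floor; rewrite lerDl.
rewrite /turns -[ltRHS]/((Posz _)%:~R) gez0_abs ?subr_ge0// intrB.
have := floor_le w; have := floorD1_gt (w + t); rewrite intrD1; lra.
Qed.

Lemma cvg_halving w : (2^-1 ^+ (2 ^ turns t w) : R) @[t --> +oo%R] --> (0 : R).
Proof.
apply/cvgrPdist_le => e e0; near=> t.
have t0 : 0 <= t by near: t; apply: nbhs_pinfty_ge; exact: num_real.
have te : e^-1 + 1 <= t by near: t; apply: nbhs_pinfty_ge; exact: num_real.
rewrite sub0r normrN ger0_norm ?exprn_ge0// exprVn.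
rewrite -[e]invrK lef_pV2 ?posrE ?invr_gt0 ?exprn_gt0//.
apply: (@le_trans _ _ (turns t w)%:R); first by have := turns_gt w t0; lra.
rewrite -natrX ler_nat; apply: ltnW.
apply: (leq_trans (ltn_expl _ (isT : (1 < 2)%N))).
by rewrite leq_exp2l// ltnW// ltn_expl.
Unshelve. all: by end_near. Qed.

Lemma stretched_attracts b w :
  dist_set (plane_rds t w @` ysection moving_point w)
    (ysection (stretched_attractor b) (rotate t w)) @[t --> +oo%R] --> 0%E.
Proof.
have : (2^-1 ^+ (2 ^ turns t w) : R)%:E @[t --> +oo%R] --> (0 : \bar R)%E.
  by apply: cvg_EFin (@cvg_halving w); near=> t.
move=> h; apply: (@squeeze_cvge _ _ _ _ (fun=> 0%E) _ _ _ _ (cvg_cst _) h).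
near=> t; rewrite image_moving_point dist_set1 dist_pt_ge0/=.
rewrite ysection_stretched level_rotate dist_stretched// exprn_ge0//=.
by rewrite exprn_ile1// invf_le1// ler1n.
Unshelve. all: by end_near. Qed.

Lemma stretched_attractorP b : random_forward_attractor
  (unit_prob : probability _ R) (rotate : R -> line -> line)
  plane_rds [set moving_point] (stretched_attractor b).
Proof.
split; first exact: compact_random_stretched.
- move=> t t0; apply: aeW => w.
  by rewrite !ysection_stretched level_rotate; exact: rescaled_power_stretched.
- by move=> _ ->; apply: aeW => w; exact: stretched_attracts.
Qed.

Lemma stretched_meet k p : stretched_segment false k p ->
  stretched_segment true k p -> p = (0, 0).
Proof.
move=> [u _ <-] [v _ [+ +]]; rewrite mul0r mul1r => + v0; rewrite v0 mulr0.
by rewrite /segment_point mul0r => <-.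
Qed.

Lemma level_ge (m : nat) w : 0 < w < 1 -> w < expR (- m%:R) ->
  (m <= level w)%N.
Proof.
move=> /andP[w0 w1] wm.
have pw : phase w = w by rewrite /phase floor_unit ?subr0// (ltW w0).
have lw : ln w <= - m%:R by rewrite -[leRHS]expRK ler_ln ?posrE ?expR_gt0 ?ltW.
rewrite /level pw truncn_ge_nat; first by rewrite lerNr.
by apply: le_trans (ler0n R m) _; rewrite lerNr.
Qed.

(** A smallest attractor A has A(w) contained in the origin almost surely.  For
every n there is then a phase c, as small as wanted, such that A(c) is so
contained; the moving point reaches it after n + 1 turns, at distance at least 1
from the origin. *)
Lemma no_smallest_attractor : ~ exists A, smallest_random_forward_attractor
  (unit_prob : probability _ R) (rotate : R -> line -> line)
  plane_rds [set moving_point] A.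
Proof.
move=> [A [[_ _ /(_ _ erefl) Aattr] Amin]].
have [w0 /andP[w00 w01] cvgA] :=
  ae_unit_prob_meets (lexx 0) ltr01 (lexx 1) Aattr.
have A0 : \forall w \ae unit_prob, ysection A w `<=` [set (0, 0)].
  apply: filterS2 (Amin _ (stretched_attractorP false))
    (Amin _ (stretched_attractorP true)).
  move=> w; rewrite !ysection_stretched => Af At p Ap.
  exact: stretched_meet (Af _ Ap) (At _ Ap).
have [M [_ Mlt]] : \forall t \near +oo%R,
    (dist_set (plane_rds t w0 @` ysection moving_point w0)
       (ysection A (rotate t w0)) < 1)%E.
  apply: (cvgA [set x | (x < 1)%E]); apply: open_nbhs_nbhs.
  by split; [exact: open_ereal_lt_ereal | rewrite /= lte_fin].
(* m is the inverse of the height h after n.+1 turns, and the stretching factor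
   is larger than m at every phase below expR (- m). *)
pose n := (Num.truncn M).+1; pose m := (2 ^ 2 ^ n.+1)%N.
have m1 : expR (- m%:R) <= 1 :> R by rewrite -expR0 ler_expR lerNl oppr0.
have [c /andP[c0 cm] Ac] :=
  ae_unit_prob_meets (lexx 0) (expR_gt0 (- m%:R)) m1 A0.
have c1 : c < 1 := lt_le_trans cm m1.
(* The time at which w0 has completed n.+1 turns and has phase c. *)
pose t := c + n.+1%:R - w0.
have w0t : w0 + t = c + (Posz n.+1)%:~R by rewrite /t; ring.
have Mt : M < t.
  have [M0|M0] := leP 0 M.
    by have /andP[_] := truncn_itv M0; rewrite /t -(natr1 n) -/n; lra.
  by rewrite /t -(natr1 n); have := ler0n R n; lra.
have fw0 : Num.floor w0 = 0 by apply: floor_unit; rewrite (ltW w00).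
have turnsE : turns t w0 = n.+1.
  by rewrite /turns w0t floorDint fw0 floor_unit ?(ltW c0)// add0r subr0.
have rotE : rotate t w0 = c.
  rewrite /rotate fw0 w0t phaseDint /phase floor_unit ?(ltW c0)//.
  by rewrite add0r subr0.
have := Mlt _ Mt.
rewrite image_moving_point dist_set1 rotE turnsE ltNge => /negP; apply.
apply: le_ereal_inf_tmp => _ [q /Ac -> <-].
rewrite lee_fin mdist_plane le_max /= sub0r normrN w0t levelDint.
rewrite ger0_norm; last by rewrite mulr_ge0// exprn_ge0.
rewrite exprVn -natrX -/m ler_pdivlMr ?mul1r ?ltr0n ?expn_gt0// ler_nat.
by rewrite (leq_trans (level_ge _ cm))// c0.
Unshelve. all: by end_near. Qed.

End Attractors.

Theorem mainTheorem3 (R : realType) :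
  exists (E : completeMetricType R),
  separable E /\
  exists (dO : measure_display) (Omega : measurableType dO)
    (P : probability Omega R) (theta : R -> Omega -> Omega)
    (phi : R -> Omega -> E -> E) (BB : set (set (E * Omega))),
  [/\ preserving_flow P theta,
      random_dynamical_system theta phi,
      BB !=set0,
      (exists A : set (E * Omega), random_forward_attractor P theta phi BB A) &
      ~ (exists A : set (E * Omega),
           smallest_random_forward_attractor P theta phi BB A)].
Proof.
exists (plane R); split; first exact: separable_plane.
exists _, (measurableTypeR R), (unit_prob : probability _ R), rotate, plane_rds,
  [set moving_point].
split.
- exact: rotate_preserving_flow.
- exact: plane_rdsP.
- by exists moving_point.
- by exists (stretched_attractor false); exact: stretched_attractorP.
- exact: no_smallest_attractor.
Qed.
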